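(* Let $T>0$, $\beta\in(0,1)$, and let $h\in C_b(\mathbb R\times[0,T])$ be locally $\beta$-Hölder continuous in $\mathbb R\times(0,T)$. Let $u:\mathbb R\times[0,T]\to\mathbb R$ be bounded and Lipschitz continuous with $u_x\in L^\infty$, such that for all $(x,t)\in\mathbb R\times[0,T]$ $$u(x,t)=\inf_{\gamma\in H^1((t,T)),\ \gamma(t)=x}\int_t^T\Big(\tfrac12|\dot\gamma(s)|^2+h(\gamma(s),s)\Big)ds+u(\gamma(T),T),$$ and such that $w(x,t):=-u(x,T-t)$ satisfies $$w(x,t)=\inf_{\gamma\in H^1((t,T)),\ \gamma(t)=x}\int_t^T\Big(\tfrac12|\dot\gamma(s)|^2+h(\gamma(s),T-s)\Big)ds+w(\gamma(T),T).$$ Then $u\in C^{1,\beta/2}_{loc}(\mathbb R\times(0,T))$.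
   Context: In the paper this is applied with $h=f(m)$, where $(u,m)$ is a solution of the one-dimensional MFG system $-u_t+\frac12u_x^2=f(m)$, $m_t-(mu_x)_x=0$ (for the planning problem, $u$ being the particular solution obtained by the approximation construction), for which both representation formulas hold. $C^{1,\beta/2}_{loc}$ means $u$ is $C^1$ in space-time with locally $\beta/2$-Hölder continuous first derivatives. *)

(* Defs.v *)
From HB Require Import structures.
From mathcomp Require Import all_boot all_order all_algebra.
From mathcomp Require Import all_classical all_reals all_analysis.
Set Implicit Arguments. Unset Strict Implicit. Unset Printing Implicit Defensive.
Import Order.TTheory GRing.Theory Num.Theory.
Import numFieldNormedType.Exports.
Local Open Scope classical_set_scope.
Local Open Scope ring_scope.

(* gamma belongs to H^1((t,T)) with weak derivative g: g is measurable and
   square integrable on [t,T] and gamma s = gamma t + int_t^s g for s in [t,T]. *)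
Definition H1_curve {R : realType} (t T : R) (gamma g : R -> R) : Prop :=
  measurable_fun `[t, T] g /\
  (\int[@lebesgue_measure R]_(s in `[t, T]) ((g s) ^+ 2)%:E < +oo)%E /\
  (forall s, t <= s <= T ->
     ((gamma s - gamma t)%:E = \int[@lebesgue_measure R]_(r in `[t, s]) (g r)%:E)%E).

Definition action {R : realType} (h : R -> R -> R) (t T : R) (gamma g : R -> R)
  : \bar R :=
  (\int[@lebesgue_measure R]_(s in `[t, T])
      (2^-1 * (g s) ^+ 2 + h (gamma s) s)%:E)%E.

Definition value {R : realType} (h : R -> R -> R) (psi : R -> R) (T x t : R)
  : \bar R :=
  ereal_inf [set v | exists gamma g : R -> R,
       [/\ gamma t = x, H1_curve t T gamma g &
            v = (action h t T gamma g + (psi (gamma T))%:E)%E]].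

Definition loc_holder_strip {R : realType} (alpha T : R) (f : R -> R -> R) : Prop :=
  forall x0 t0, 0 < t0 < T ->
  exists r C : R, 0 < r /\
    forall x s y t, 0 < s < T -> 0 < t < T ->
      `|x - x0| < r -> `|s - t0| < r -> `|y - x0| < r -> `|t - t0| < r ->
      `|f x s - f y t| <= C * (Num.max `|x - y| `|s - t|) `^ alpha.

(* Main.v *)
(* The representation formulas for [u] and for [w(x,t) = - u(x,T-t)] say that [u]
   satisfies the dynamic programming inequality along every curve, and that it is
   nearly an equality along suitable curves leaving any point [(x,t)], both forward
   and backward in time. Bending a near-optimal forward curve by
   [k (1 - (s - t) / delta)] on [[t, t + delta]] gives an upper bound
   [u(x+k,t) - u(x,t) <= v k + O(k^2 / delta + delta |k|^beta)]; taking
   [delta = rho^(1 - beta/2)] makes the error [O(rho^(1 + beta/2))] for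
   [|k| <= rho]. The backward curve (the same estimate for [w]) gives the reverse
   bound, so at every scale [u(.,t)] is affine up to [O(rho^(1 + beta/2))], whence
   it is [C^(1,beta/2)], by Campanato's argument. The Hopf-Lax formula over a short
   time then yields
   [u(x,t) - u(x,b) = (b - t) (h - u_x(x,b)^2 / 2) + O((b - t)^(1 + beta/2))],
   which gives first the Hoelder continuity of [u_x] in time (through the mixed
   difference of [u]) and then [u_t = u_x^2 / 2 - h]. *)
Require Import Defs.
From HB Require Import structures.
From mathcomp Require Import all_boot all_order all_algebra.
From mathcomp Require Import all_classical all_reals all_analysis.
From mathcomp Require Import measurable_realfun ring lra.
Set Implicit Arguments.
Unset Strict Implicit.
Unset Printing Implicit Defensive.
Import Order.TTheory GRing.Theory Num.Theory.
Import numFieldNormedType.Exports.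
Local Open Scope classical_set_scope.
Local Open Scope ring_scope.

(** * Curves of finite energy *)

Section H1_curves.
Context {R : realType}.
Notation mu := (@lebesgue_measure R).
Implicit Types (a b c s : R) (gamma g f : R -> R).

Lemma integrable_itv_cst a b (k : R) : mu.-integrable `[a, b] (EFin \o cst k).
Proof.
apply: measurable_bounded_integrable => //=; last exact: bounded_cst.
by rewrite lebesgue_measure_itv/=; case: ifPn => // _; rewrite -EFinB ltry.
Qed.

Lemma Rintegral_itv_cst a b (k : R) : a <= b ->
  \int[mu]_(s in `[a, b]) k = k * (b - a).
Proof.
rewrite le_eqVlt => /predU1P[->|ab].
  by rewrite set_itv1 Rintegral_set1 subrr mulr0.
by rewrite Rintegral_cst//= lebesgue_measure_itv/= lte_fin ab.
Qed.

Lemma integrable_itvS (a b a' b' : R) f : a <= a' -> b' <= b ->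
  mu.-integrable `[a, b] (EFin \o f) -> mu.-integrable `[a', b'] (EFin \o f).
Proof.
move=> aa' bb'; apply: integrableS => //.
by apply: subset_itv; rewrite bnd_simp.
Qed.

Lemma Rintegral_itv_cat a c b f : a <= c -> c <= b ->
  mu.-integrable `[a, b] (EFin \o f) ->
  \int[mu]_(s in `[a, b]) f s =
  \int[mu]_(s in `[a, c]) f s + \int[mu]_(s in `[c, b]) f s.
Proof.
move=> ac cb fi.
have := @Rintegral_itvB R f (BLeft a) (BRight b) c fi.
rewrite !bnd_simp => /(_ ac cb) H.
rewrite -(@Rintegral_itv_obnd_cbnd R c (BRight b) f); last first.
  apply: integrableS fi => //.
  by apply: subset_itv; rewrite ?bnd_simp.
by rewrite -H addrC subrK.
Qed.

Lemma le_Rintegral_itvD a b c f f' : a <= b ->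
  mu.-integrable `[a, b] (EFin \o f) -> mu.-integrable `[a, b] (EFin \o f') ->
  (forall s, a <= s <= b -> f s <= f' s + c) ->
  \int[mu]_(s in `[a, b]) f s <= \int[mu]_(s in `[a, b]) f' s + c * (b - a).
Proof.
move=> ab fi f'i ff'.
rewrite -Rintegral_itv_cst// -RintegralD//; last exact: integrable_itv_cst.
apply: le_Rintegral => //.
  have := integrableD _ f'i (integrable_itv_cst a b c).
  by apply.
Qed.

Section fixed_curve.
Context {a b : R} {gamma g : R -> R}.
Hypothesis ab : a <= b.
Hypothesis Hg : H1_curve a b gamma g.

Lemma H1_integrable_sqr :
  mu.-integrable `[a, b] (EFin \o (fun s => g s ^+ 2)).
Proof.
case: Hg => mg [ig _]; apply/integrableP; split.
  by apply/measurable_EFinP; exact: measurable_funX.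
under eq_integral do rewrite /= ger0_norm ?sqr_ge0//.
exact: ig.
Qed.

(** On a bounded interval [g ^+ 2 + 1] is integrable, and it dominates [g] in absolute value. *)
Lemma H1_integrable : mu.-integrable `[a, b] (EFin \o g).
Proof.
have i1 : mu.-integrable `[a, b] (EFin \o (fun s => g s ^+ 2 + 1)).
  have := integrableD _ H1_integrable_sqr (integrable_itv_cst a b 1).
  by apply.
apply: le_integrable i1 => //.
  by case: Hg => mg _; exact/measurable_EFinP.
move=> s _ /=; rewrite lee_fin [leRHS]ger0_norm ?addr_ge0 ?sqr_ge0//.
rewrite ler_norml; apply/andP; split; nra.
Qed.

Lemma H1_incr s : a <= s <= b ->
  gamma s - gamma a = \int[mu]_(r in `[a, s]) g r.
Proof.
by case: Hg => _ [_ /(_ s)] /[apply] e; rewrite /Rintegral -e.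
Qed.

Lemma H1_continuous : {within `[a, b], continuous gamma}.
Proof.
have H := parameterized_integral_continuous ab H1_integrable.
apply: (@subspace_eq_continuous _ _ _ (fun s => gamma a + parameterized_integral mu a s g)).
  move=> s; rewrite inE/= in_itv/= => sab.
  by rewrite /parameterized_integral -H1_incr// addrC subrK.
apply: within_continuousD => //.
exact: continuous_subspaceT (@cst_continuous _ _ _).
Qed.

End fixed_curve.

(** Membership is rephrased with real-valued integrals, on which [ring] and [lra] can act;
    integrability of [g] is what lets [Rintegral] be turned back into the extended integral. *)
Lemma H1_curveI a b gamma g :
  mu.-integrable `[a, b] (EFin \o g) ->
  mu.-integrable `[a, b] (EFin \o (fun s => g s ^+ 2)) ->
  (forall s, a <= s <= b -> gamma s - gamma a = \int[mu]_(r in `[a, s]) g r) ->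
  H1_curve a b gamma g.
Proof.
move=> gi g2i gs; split.
  by move: (measurable_int _ gi) => /measurable_EFinP.
split.
  case/integrableP : g2i => _; under eq_integral do rewrite /= ger0_norm ?sqr_ge0//.
  by [].
move=> s sab; rewrite gs// fineK//; apply: integrable_fin_num => //.
by case/andP: sab => _ sb; exact: integrable_itvS (lexx a) sb gi.
Qed.

Lemma H1_curveS a b a' b' gamma g : a <= a' -> a' <= b' -> b' <= b ->
  H1_curve a b gamma g -> H1_curve a' b' gamma g.
Proof.
move=> aa' a'b' b'b Hg; have ab : a <= b by lra.
apply: H1_curveI.
- exact: integrable_itvS aa' b'b (H1_integrable Hg).
- exact: integrable_itvS aa' b'b (H1_integrable_sqr Hg).
- move=> s /andP[a's sb'].
  have -> : gamma s - gamma a' = (gamma s - gamma a) - (gamma a' - gamma a) by ring.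
  rewrite (H1_incr Hg); last lra.
  rewrite (H1_incr Hg); last lra.
  rewrite (Rintegral_itv_cat aa' a's); first by rewrite addrAC subrr add0r.
  apply: integrable_itvS (H1_integrable Hg) => //; lra.
Qed.

End H1_curves.

(** * Gluing and bending curves; Cauchy-Schwarz *)

Section H1_curve_operations.
Context {R : realType}.
Notation mu := (@lebesgue_measure R).
Implicit Types (a b c d s : R) (gamma g f : R -> R).

Lemma integrable_itv_cat a c b f : a <= c -> c <= b ->
  mu.-integrable `[a, c] (EFin \o f) -> mu.-integrable `]c, b] (EFin \o f) ->
  mu.-integrable `[a, b] (EFin \o f).
Proof.
move=> ac cb /integrableP[m1 i1] /integrableP[m2 i2].
rewrite (@itv_bndbnd_setU _ _ (BLeft a) (BRight c) (BRight b)) ?bnd_simp//.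
apply/integrableP; split; first by apply/measurable_funU.
rewrite ge0_integral_setU//=.
- by rewrite lte_add_pinfty.
- do 2 apply: measurableT_comp => //; apply/measurable_EFinP; by apply/measurable_funU.
- apply/disj_setPS => y [/=]; rewrite 2!in_itv/= => /andP[_ yx] /andP[].
  by rewrite ltNge yx.
Qed.

Section concatenation.
Context {a b c : R} {f f1 f2 : R -> R}.
Hypotheses (ac : a <= c) (cb : c <= b).
Hypothesis f1E : forall s, a <= s <= c -> f s = f1 s.
Hypothesis f2E : forall s, c < s <= b -> f s = f2 s.
Hypothesis if1 : mu.-integrable `[a, c] (EFin \o f1).
Hypothesis if2 : mu.-integrable `[c, b] (EFin \o f2).

Let if2' : mu.-integrable `]c, b] (EFin \o f2).
Proof.
apply: integrableS if2 => //.
by apply: subset_itv; rewrite ?bnd_simp.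
Qed.

Let fi2 : mu.-integrable `]c, b] (EFin \o f).
Proof.
apply: eq_integrable if2' => // s; rewrite inE/= in_itv/= => scb.
by rewrite f2E.
Qed.

Let fi1 : mu.-integrable `[a, c] (EFin \o f).
Proof.
apply: eq_integrable if1 => // s; rewrite inE/= in_itv/= => scb.
by rewrite f1E.
Qed.

(** At the junction [c] a glued function keeps the value of its first piece, so [f] agrees with [f2]
    on []c, b]] only; the point [c] is negligible. *)
Lemma integrable_concat : mu.-integrable `[a, b] (EFin \o f).
Proof. exact: integrable_itv_cat ac cb fi1 fi2. Qed.

Lemma Rintegral_concat : \int[mu]_(s in `[a, b]) f s =
  \int[mu]_(s in `[a, c]) f1 s + \int[mu]_(s in `[c, b]) f2 s.
Proof.
rewrite (Rintegral_itv_cat ac cb integrable_concat); congr (_ + _).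
  by apply: eq_Rintegral => s; rewrite inE/= in_itv/= => /f1E.
rewrite -!Rintegral_itv_obnd_cbnd//.
by apply: eq_Rintegral => s; rewrite inE/= in_itv/= => /f2E.
Qed.

End concatenation.

Lemma H1_curve_concat a c b gamma1 g1 gamma2 g2 : a <= c -> c <= b ->
  gamma1 c = gamma2 c -> H1_curve a c gamma1 g1 -> H1_curve c b gamma2 g2 ->
  H1_curve a b (fun s => if s <= c then gamma1 s else gamma2 s)
               (fun s => if s <= c then g1 s else g2 s).
Proof.
move=> ac cb e H1 H2.
have le1 s (z1 z2 : R) : a <= s <= c -> (if s <= c then z1 else z2) = z1.
  by case/andP => _ ->.
have gt2 s b' (z1 z2 : R) : c < s <= b' -> (if s <= c then z1 else z2) = z2.
  by case/andP; rewrite ltNge => /negbTE ->.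
apply: H1_curveI.
- apply: (@integrable_concat a b c _ g1 g2) => //.
  + by move=> s; exact: le1.
  + by move=> s; exact: gt2.
  + exact: H1_integrable H1.
  + exact: H1_integrable H2.
- apply: (@integrable_concat a b c _ (fun s => g1 s ^+ 2) (fun s => g2 s ^+ 2)) => //.
  + by move=> s sc; rewrite (le1 s).
  + by move=> s sc; rewrite (gt2 s b).
  + exact: H1_integrable_sqr H1.
  + exact: H1_integrable_sqr H2.
- move=> s /andP[as_ sb]; rewrite ac; have [sc|cs] := leP s c.
    rewrite (H1_incr H1); last lra.
    apply: eq_Rintegral => r; rewrite inE/= in_itv/= => ras.
    by rewrite (le1 r)//; lra.
  rewrite (@Rintegral_concat a s c _ g1 g2 ac (ltW cs)).
  + have -> : gamma2 s - gamma1 a = (gamma1 c - gamma1 a) + (gamma2 s - gamma2 c).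
      by rewrite e; ring.
    by rewrite (H1_incr H1) ?(H1_incr H2)//; lra.
  + by move=> r; exact: le1.
  + by move=> r; exact: gt2.
  + exact: H1_integrable H1.
  + exact: integrable_itvS (lexx c) sb (H1_integrable H2).
Qed.

Section affine_perturbation.
Context {a b : R} {gamma g : R -> R}.
Hypotheses (ab : a <= b) (Hg : H1_curve a b gamma g).
Variables (c d : R).

Let ig := H1_integrable Hg.
Let ig2 := H1_integrable_sqr Hg.
Let i1 := integrable_itv_cst a b.

Let icg : mu.-integrable `[a, b] (EFin \o (fun s => (c *+ 2) * g s)).
Proof. by have := integrableZl _ (c *+ 2) ig; apply. Qed.

Let icgc : mu.-integrable `[a, b] (EFin \o (fun s => (c *+ 2) * g s + c ^+ 2)).
Proof. by have := integrableD _ icg (i1 (c ^+ 2)); apply. Qed.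

Let sqrE : (fun s => (g s + c) ^+ 2) =
  (fun s => g s ^+ 2 + ((c *+ 2) * g s + c ^+ 2)).
Proof. by apply/funext => s; ring. Qed.

(** Two uses: bending a near-optimal curve so that it starts at [x + k] and keeps its end, and
    producing straight lines from a constant curve. *)
Lemma H1_curve_affine :
  H1_curve a b (fun s => gamma s + (c * (s - a) + d)) (fun s => g s + c).
Proof.
apply: H1_curveI.
- by have := integrableD _ ig (i1 c); apply.
- by rewrite sqrE; have := integrableD _ ig2 icgc; apply.
- move=> s /andP[as_ sb]; have igs := integrable_itvS (lexx a) sb ig.
  rewrite RintegralD//; last exact: integrable_itv_cst.
  rewrite Rintegral_itv_cst// -(H1_incr Hg); last lra.
  ring.
Qed.

(** The added velocity is constant, so the cross term integrates exactly to the increment of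
    [gamma]; this is why the bends are affine. *)
Lemma Rintegral_sqr_affine :
  \int[mu]_(s in `[a, b]) (g s + c) ^+ 2 =
  \int[mu]_(s in `[a, b]) g s ^+ 2 + c *+ 2 * (gamma b - gamma a) +
    c ^+ 2 * (b - a).
Proof.
rewrite sqrE (RintegralD _ ig2 icgc)// (RintegralD _ icg (i1 (c ^+ 2)))//.
rewrite (RintegralZl (c *+ 2) _ ig)// Rintegral_itv_cst//.
by rewrite (H1_incr Hg) ?addrA// ab lexx.
Qed.

End affine_perturbation.

Lemma H1_curve_cst a b x : H1_curve a b (fun=> x) (fun=> 0).
Proof.
apply: H1_curveI.
- exact: integrable_itv_cst.
- by rewrite (_ : _ \o _ = EFin \o cst 0);
    [exact: integrable_itv_cst|apply/funext => s /=; rewrite expr0n].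
- by move=> s /andP[as_ sb]; rewrite Rintegral_itv_cst// mul0r subrr.
Qed.

(** The energy left after subtracting the mean velocity on [[a, s]] is nonnegative; expanding it
    with [Rintegral_sqr_affine] gives the inequality. *)
Lemma H1_curve_CauchySchwarz a b s gamma g : a <= s <= b ->
  H1_curve a b gamma g ->
  (gamma s - gamma a) ^+ 2 <= (s - a) * \int[mu]_(r in `[a, b]) g r ^+ 2.
Proof.
move=> /andP[as_ sb] Hg.
have Hs := H1_curveS (lexx a) as_ sb Hg.
have le2 : \int[mu]_(r in `[a, s]) g r ^+ 2 <= \int[mu]_(r in `[a, b]) g r ^+ 2.
  rewrite (Rintegral_itv_cat as_ sb (H1_integrable_sqr Hg)) lerDl.
  by apply: Rintegral_ge0 => r _; exact: sqr_ge0.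
apply: le_trans (ler_wpM2l _ le2); last by rewrite subr_ge0.
move: as_; rewrite le_eqVlt => /predU1P[<-|as_]; first by rewrite !subrr expr0n mul0r.
have sa : 0 < s - a by rewrite subr_gt0.
have := Rintegral_sqr_affine (ltW as_) Hs (- ((gamma s - gamma a) / (s - a))).
set I := Rintegral _ _ _ => e.
have : 0 <= I by apply: Rintegral_ge0 => r _; exact: sqr_ge0.
rewrite {}e; set J := Rintegral _ _ _; set D := gamma s - gamma a.
have -> : J + - (D / (s - a)) *+ 2 * D + (- (D / (s - a))) ^+ 2 * (s - a)
   = J - D ^+ 2 / (s - a) by field; rewrite gt_eqF.
by rewrite subr_ge0 ler_pdivrMr// mulrC.
Qed.

End H1_curve_operations.

(** * Dynamic programming *)

Section dynamic_programming.
Context {R : realType}.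
Notation mu := (@lebesgue_measure R).
Variables (T M : R) (h u : R -> R -> R).
Hypothesis h_cont :
  {within [set p : R * R | 0 <= p.2 <= T], continuous (fun p => h p.1 p.2)}.
Hypothesis h_bnd : forall x t, 0 <= t <= T -> `|h x t| <= M.
Implicit Types (a b c d s t x : R) (gamma g : R -> R).

Lemma potential_continuous a b gamma : 0 <= a -> b <= T ->
  {within `[a, b], continuous gamma} ->
  {within `[a, b], continuous (fun s => h (gamma s) s)}.
Proof.
move=> a0 bT /subspace_continuousP cg; apply/subspace_continuousP => s sab.
have sT : 0 <= s <= T by move: sab; rewrite /= in_itv/= => /andP[]; lra.
move/subspace_continuousP : h_cont => /(_ (gamma s, s) sT) ch.
apply: (@cvg_comp _ _ _ (fun r => (gamma r, r)) (fun p => h p.1 p.2)); last exact: ch.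
have cp : (gamma r, r) @[r --> within `[a, b] (nbhs s)] --> (gamma s, s).
  have c2 : r @[r --> within `[a, b] (nbhs s)] --> s.
    by apply: cvg_within_filter; exact: cvg_id.
  exact: cvg_pair (cg s sab) c2.
(* The graph converges in the whole plane while [h] is continuous only within the strip; the two
   compose because the graph over [[a, b]] stays in the strip. *)
move=> P; rewrite nbhs_simpl/= => wP; have := cp _ wP; rewrite !nbhs_simpl/=.
rewrite /within/= => H; near=> r => rab.
have := near H r; apply => //.
by move: rab; rewrite in_itv/= => /andP[]; lra.
Unshelve. all: by end_near. Qed.

Section along_curve.
Context {a b : R} {gamma g : R -> R}.
Hypotheses (a0 : 0 <= a) (ab : a <= b) (bT : b <= T).
Hypothesis (Hg : H1_curve a b gamma g).

Lemma potential_integrable :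
  mu.-integrable `[a, b] (EFin \o (fun s => h (gamma s) s)).
Proof.
apply: measurable_bounded_integrable => //=.
- by rewrite lebesgue_measure_itv/=; case: ifPn => // _; rewrite -EFinB ltry.
- apply: subspace_continuous_measurable_fun => //.
  exact: potential_continuous (H1_continuous ab Hg).
- exists M; split; first exact: num_real.
  move=> N MN s /=; rewrite in_itv/= => /andP[as_ sb].
  apply: le_trans (ltW MN).
  by apply: h_bnd; rewrite (le_trans a0 as_) (le_trans sb bT).
Qed.

Lemma actionE : action h a b gamma g =
  (2^-1 * \int[mu]_(s in `[a, b]) g s ^+ 2 +
   \int[mu]_(s in `[a, b]) h (gamma s) s)%:E.
Proof.
have ig2 : mu.-integrable `[a, b] (EFin \o (fun s => 2^-1 * g s ^+ 2)).
  by have := integrableZl _ (2^-1) (H1_integrable_sqr Hg); apply.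
rewrite -RintegralZl//; last exact: H1_integrable_sqr Hg.
rewrite -(RintegralD _ ig2 potential_integrable)//.
rewrite /action /Rintegral fineK//; apply: integrable_fin_num => //.
by have := integrableD _ ig2 potential_integrable; apply.
Qed.

End along_curve.

Hypothesis u_value : forall x t, 0 <= t <= T ->
  (u x t)%:E = value h (fun y => u y T) T x t.

Lemma value_le t gamma g : 0 <= t <= T -> H1_curve t T gamma g ->
  u (gamma t) t <= 2^-1 * \int[mu]_(s in `[t, T]) g s ^+ 2 +
    \int[mu]_(s in `[t, T]) h (gamma s) s + u (gamma T) T.
Proof.
move=> /andP[t0 tT] Hg; rewrite -lee_fin u_value ?t0// EFinD -actionE//.
by apply: ereal_inf_lbound; exists gamma, g; split.
Qed.

(** The infimum equals the real number [u x t], hence is finite and is approached within any [e]; no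
    minimiser has to exist. *)
Lemma value_near_optimal x t e : 0 <= t <= T -> 0 < e -> exists gamma g,
  [/\ gamma t = x, H1_curve t T gamma g &
   2^-1 * \int[mu]_(s in `[t, T]) g s ^+ 2 +
    \int[mu]_(s in `[t, T]) h (gamma s) s + u (gamma T) T <= u x t + e].
Proof.
move=> /andP[t0 tT] e0.
have := @lb_ereal_inf_adherent R [set v | exists gamma g : R -> R,
  [/\ gamma t = x, H1_curve t T gamma g &
      v = (action h t T gamma g + (u (gamma T) T)%:E)%E]] e e0.
rewrite -/(value h (fun y => u y T) T x t) -u_value ?t0//.
move=> /(_ isT)[_ [gamma [g [gx Hg ->]]] lt]; exists gamma, g; split => //.
by move: lt; rewrite actionE// -!EFinD lte_fin; exact: ltW.
Qed.

(** First half of dynamic programming: continue the curve after [b] by an [e]-optimal one leaving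
    [gamma b], test the formula on the glued curve, and let [e] vary. *)
Lemma value_le_before a b gamma g : 0 <= a -> a <= b -> b <= T ->
  H1_curve a b gamma g ->
  u (gamma a) a <= 2^-1 * \int[mu]_(s in `[a, b]) g s ^+ 2 +
    \int[mu]_(s in `[a, b]) h (gamma s) s + u (gamma b) b.
Proof.
move=> a0 ab bT H1; apply/ler_addgt0Pr => e e0.
have bT' : 0 <= b <= T by lra.
have [gamma2 [g2 [eq2 H2 near2]]] := @value_near_optimal (gamma b) b e bT' e0.
apply: (@le_trans _ _ (2^-1 * \int[mu]_(s in `[a, b]) g s ^+ 2 +
    \int[mu]_(s in `[a, b]) h (gamma s) s +
  (2^-1 * \int[mu]_(s in `[b, T]) g2 s ^+ 2 +
    \int[mu]_(s in `[b, T]) h (gamma2 s) s + u (gamma2 T) T))); last first.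
  by rewrite -(addrA _ (u (gamma b) b)) lerD2l.
have H := H1_curve_concat ab bT (esym eq2) H1 H2.
have aT : 0 <= a <= T by lra.
have := value_le aT H; rewrite ab.
rewrite (@Rintegral_concat _ a T b _ (fun s => g s ^+ 2) (fun s => g2 s ^+ 2)
  ab bT); first last.
- exact: H1_integrable_sqr H2.
- exact: H1_integrable_sqr H1.
- by move=> s /andP[]; rewrite ltNge => /negbTE ->.
- by move=> s /andP[_ ->].
rewrite (@Rintegral_concat _ a T b _ (fun s => h (gamma s) s)
  (fun s => h (gamma2 s) s) ab bT); first last.
- by apply: potential_integrable H2 => //; lra.
- exact: potential_integrable H1.
- by move=> s /andP[]; rewrite ltNge => /negbTE ->.
- by move=> s /andP[_ ->].
(* If [b = T] the glued curve ends on its first branch, and the two branches agree there. *)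
have -> : (if T <= b then gamma T else gamma2 T) = gamma2 T.
  by case: ifPn => // Tb; have -> : T = b by lra.
move/le_trans; apply; rewrite le_eqVlt; apply/orP; left; apply/eqP; ring.
Qed.

(** Second half of dynamic programming: cut an [e]-optimal curve at [b]; its remaining cost is at
    least [u (gamma b) b]. *)
Lemma value_near_optimal_before x t b e :
  0 <= t -> t <= b -> b <= T -> 0 < e -> exists gamma g,
  [/\ gamma t = x, H1_curve t b gamma g &
   2^-1 * \int[mu]_(s in `[t, b]) g s ^+ 2 +
    \int[mu]_(s in `[t, b]) h (gamma s) s + u (gamma b) b <= u x t + e].
Proof.
move=> t0 tb bT e0; have tT : 0 <= t <= T by lra.
have [gamma [g [gx Hg opt]]] := value_near_optimal x tT e0.
exists gamma, g; split => //; first exact: H1_curveS Hg.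
have H2 := H1_curveS tb bT (lexx T) Hg.
have b0 : 0 <= b <= T by lra.
have := value_le b0 H2.
move: opt; rewrite (Rintegral_itv_cat tb bT (H1_integrable_sqr Hg)).
have hi : mu.-integrable `[t, T] (EFin \o (fun s => h (gamma s) s)).
  by apply: potential_integrable Hg => //; lra.
rewrite (Rintegral_itv_cat tb bT hi).
lra.
Qed.

End dynamic_programming.

(** * Near-optimal curves *)

(** The radius is shrunk until the time interval lies in [(0,T)], the constant is made nonnegative,
    and the maximum is replaced by any common bound [d]. *)
Lemma loc_holder_ball (R : realType) (alpha T : R) (f : R -> R -> R) x0 t0 :
  0 <= alpha -> 0 < t0 < T -> loc_holder_strip alpha T f ->
  exists r C : R, [/\ 0 < r, 0 <= C,
    forall t, `|t - t0| < r -> 0 < t < T &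
    forall x s y t d, `|x - x0| < r -> `|s - t0| < r ->
      `|y - x0| < r -> `|t - t0| < r -> `|x - y| <= d -> `|s - t| <= d ->
      `|f x s - f y t| <= C * d `^ alpha].
Proof.
move=> alpha0 t0T /(_ x0 t0 t0T)[r [C [r0 fC]]].
pose r' := Num.min r (Num.min t0 (T - t0)).
have r'r : r' <= r by rewrite /r' ge_min lexx.
have r't0 : r' <= t0 by rewrite /r' !ge_min lexx orbT.
have r'T : r' <= T - t0 by rewrite /r' !ge_min lexx !orbT.
have r'0 : 0 < r' by rewrite /r' !lt_min r0; lra.
have r'in t : `|t - t0| < r' -> 0 < t < T by rewrite ltr_norml; lra.
exists r', `|C|; split => // x s y t d xr sr yr tr xy st.
apply: (@le_trans _ _ (C * Num.max `|x - y| `|s - t| `^ alpha)).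
  by apply: fC; [exact: r'in|exact: r'in|lra|lra|lra|lra].
apply: (@le_trans _ _ (`|C| * Num.max `|x - y| `|s - t| `^ alpha)).
  by rewrite ler_wpM2r ?powR_ge0// ler_norm.
rewrite ler_wpM2l// ge0_ler_powR// ?nnegrE.
- by rewrite le_max normr_ge0.
- by rewrite (le_trans _ xy).
- by rewrite ge_max xy st.
Qed.

Section near_optimal_curves.
Context {R : realType}.
Notation mu := (@lebesgue_measure R).
Variables (T M L : R) (h u : R -> R -> R).
Hypothesis T_gt0 : 0 < T.
Hypothesis h_cont :
  {within [set p : R * R | 0 <= p.2 <= T], continuous (fun p => h p.1 p.2)}.
Hypothesis h_bnd : forall x t, 0 <= t <= T -> `|h x t| <= M.
Hypothesis u_value : forall x t, 0 <= t <= T ->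
  (u x t)%:E = value h (fun y => u y T) T x t.
Hypothesis u_lip : forall x s y t, 0 <= s <= T -> 0 <= t <= T ->
       `|u x s - u y t| <= L * (`|x - y| + `|s - t|).
Implicit Types (a b c d s t x : R) (gamma g : R -> R).

Let M_ge0 : 0 <= M.
Proof.
have T0 : 0 <= (0 : R) <= T by apply/andP; split; [exact: lexx|exact: ltW].
exact: le_trans (normr_ge0 _) (h_bnd 0 T0).
Qed.

Let L_ge0 : 0 <= L.
Proof.
have T0 : 0 <= (0 : R) <= T by apply/andP; split; [exact: lexx|exact: ltW].
have := le_trans (normr_ge0 _) (u_lip 1 0 T0 T0).
by rewrite subrr subr0 !normr0 normr1 addr0 mulr1.
Qed.

(** Bound for the mean energy of near-optimal curves, and for their mean speed as well since [K] is
    at least [1]. *)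
Let K := 4 * (L ^+ 2 + L + M + 1).

Let K_ge1 : 1 <= K.
Proof. by rewrite /K; have := sqr_ge0 L; have := M_ge0; have := L_ge0; lra. Qed.

(** Near-optimality and the Lipschitz bound on [u] control the energy by the displacement, and the
    displacement is at most the square root of [tau * E]; absorbing it gives [E <= K * tau], and
    Cauchy-Schwarz concludes. *)
Lemma near_optimal_speed t b gamma g s : 0 <= t -> t < b -> b <= T ->
  H1_curve t b gamma g ->
  2^-1 * \int[mu]_(s in `[t, b]) g s ^+ 2 +
    \int[mu]_(s in `[t, b]) h (gamma s) s + u (gamma b) b <=
    u (gamma t) t + (b - t) ->
  t <= s <= b -> `|gamma s - gamma t| <= K * (b - t).
Proof.
have [M0 L0 K1] := And3 M_ge0 L_ge0 K_ge1.
move=> t0 tb bT Hg opt sb; have tb' := ltW tb.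
have tauP : 0 < b - t by lra.
set tau := b - t in tauP opt *.
set E := \int[mu]_(s in _) _ ^+ 2 in opt.
have E0 : 0 <= E by apply: Rintegral_ge0 => r _; exact: sqr_ge0.
have CSb : (gamma b - gamma t) ^+ 2 <= tau * E.
  by apply: H1_curve_CauchySchwarz Hg; rewrite tb' lexx.
have CSs : (gamma s - gamma t) ^+ 2 <= (s - t) * E.
  exact: H1_curve_CauchySchwarz Hg.
have hM : - (M * tau) <= \int[mu]_(s in `[t, b]) h (gamma s) s.
  have hi := potential_integrable h_cont h_bnd t0 tb' bT Hg.
  have := le_Rintegral_itvD tb' (integrable_itv_cst t b 0) hi (c := M).
  rewrite Rintegral_itv_cst// mul0r -/tau => H.
  suff : 0 <= \int[mu]_(s in `[t, b]) h (gamma s) s + M * tau by lra.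
  apply: H => r /andP[tr rb].
  have rT : 0 <= r <= T by rewrite (le_trans t0 tr) (le_trans rb bT).
  by rewrite /=; have := h_bnd (gamma r) rT; rewrite ler_norml; lra.
have EK : E <= K * tau.
  have uu : u (gamma t) t - u (gamma b) b <= L * (`|gamma b - gamma t| + tau).
    have tT : 0 <= t <= T by lra.
    have bT' : 0 <= b <= T by rewrite (le_trans t0 tb') bT.
    have := u_lip (gamma t) (gamma b) tT bT'.
    rewrite (distrC (gamma t)) (distrC t b) (gtr0_norm tauP).
    exact: le_trans (ler_norm _).
  have D2 : `|gamma b - gamma t| ^+ 2 <= tau * E by rewrite real_normK ?num_real.
  have := normr_ge0 (gamma b - gamma t).
  move: D2 uu; set D := `|_| => D2 uu D0.
  (* Young's inequality, weighted so that only half of the kinetic term [E / 2] is absorbed;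
     multiplying by [tau] makes [D ^+ 2 <= tau * E] applicable. *)
  have LD : L * D <= L ^+ 2 * tau + E / 4.
    rewrite -(ler_pM2l tauP).
    have : 0 <= (L * tau - D / 2) ^+ 2 by exact: sqr_ge0.
    nra.
  have KE : K * tau = 4 * (L ^+ 2 * tau) + 4 * (L * tau) + 4 * (M * tau) + 4 * tau.
    by rewrite /K; ring.
  lra.
have K0 : 0 <= K := le_trans ler01 K1.
have Kt0 : 0 <= K * tau by rewrite mulr_ge0// ltW.
rewrite -ler_sqr ?nnegrE//.
rewrite real_normK ?num_real//.
apply: (le_trans CSs).
have st : s - t <= tau by rewrite /tau; lra.
apply: (@le_trans _ _ (tau * (K * tau))).
  by apply: ler_pM => //; rewrite subr_ge0; case/andP: sb.
have -> : (K * tau) ^+ 2 = K * (tau * (K * tau)) by ring.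
by rewrite ler_peMl// mulr_ge0// ltW.
Qed.

(** * One-sided slopes and short-time expansion near a point *)

Section local_estimates.
Variables (beta x0 t0 r C : R).
Hypotheses (beta01 : 0 < beta < 1) (r_gt0 : 0 < r) (C_ge0 : 0 <= C).
Hypothesis r_strip : forall t, `|t - t0| < r -> 0 < t < T.
Hypothesis h_holder : forall x s y t d, `|x - x0| < r -> `|s - t0| < r ->
  `|y - x0| < r -> `|t - t0| < r -> `|x - y| <= d -> `|s - t| <= d ->
  `|h x s - h y t| <= C * d `^ beta.

(* The last three hypotheses are those met by [delta = rho `^ (1 - beta / 2)] when
   [rho <= 1]: they balance the errors [k ^+ 2 / delta] and [delta * rho `^ beta]. *)
Lemma one_sided_slope_at (x t rho delta : R) : `|x - x0| + K * delta + rho < r ->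
  `|t - t0| + delta < r -> 0 < rho -> 0 < delta ->
  delta * rho `^ beta = rho `^ (1 + beta / 2) ->
  rho `^ (1 + beta / 2) * delta = rho ^+ 2 ->
  rho `^ (1 + beta / 2) <= delta ->
  exists v : R, forall k : R, `|k| <= rho ->
    u (x + k) t - u x t <= v * k + (C + 2) * rho `^ (1 + beta / 2).
Proof.
move=> xr tr rho0 delta0 rhob rho2 rhod.
have K0 : 0 <= K := le_trans ler01 K_ge1.
have /andP[t_gt0 tT] : 0 < t < T by apply: r_strip; lra.
have t0' := ltW t_gt0.
pose b := t + delta.
have tb : t < b by rewrite /b; lra.
have bt : b - t = delta by rewrite /b; ring.
have bT : b <= T.
  have := ler_norm (t - t0); have := ler_norm (t0 - t); rewrite (distrC t0) => ? ?.
  have /andP[_ /ltW//] : 0 < b < T.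
  by apply: r_strip; rewrite /b ltr_norml; lra.
pose e := rho `^ (1 + beta / 2).
have e0 : 0 < e by exact: powR_gt0.
have [gamma [g [gx Hg opt]]] :=
  value_near_optimal_before h_cont h_bnd u_value x t0' (ltW tb) bT e0.
have speed s : t <= s <= b -> `|gamma s - x| <= K * delta.
  move=> stb; rewrite -gx -bt; apply: (near_optimal_speed t0' tb bT Hg) => //.
  by rewrite gx bt; apply: le_trans opt _; rewrite lerD2l.
(* Minus the mean velocity: the bend has velocity [- (k / delta)], and half of its cross term with
   [g] is this slope times [k]. *)
exists (- ((gamma b - x) / delta)) => k krho.
have Hk := H1_curve_affine Hg (- (k / delta)) k.
have := value_le_before h_cont h_bnd u_value t0' (ltW tb) bT Hk.
rewrite (Rintegral_sqr_affine (ltW tb) Hg) gx bt subrr mulr0 add0r.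
have -> : gamma b + (- (k / delta) * delta + k) = gamma b.
  by rewrite mulNr divfK ?gt_eqF// addNr addr0.
set J := \int[mu]_(s in _) h (_ + _) s.
set I := \int[mu]_(s in _) h _ _ in opt.
set E := \int[mu]_(s in _) _ ^+ 2 in opt *.
have JI : J <= I + C * rho `^ beta * delta.
  have iHk := potential_integrable h_cont h_bnd t0' (ltW tb) bT Hk.
  have iHg := potential_integrable h_cont h_bnd t0' (ltW tb) bT Hg.
  have := le_Rintegral_itvD (ltW tb) iHk iHg (c := C * rho `^ beta).
  rewrite bt; apply.
  move=> s stb; rewrite -lerBlDl; apply: le_trans (ler_norm _) _.
  pose z := - (k / delta) * (s - t) + k; rewrite -/z.
  have zk : `|z| <= `|k|.
    have -> : z = k * (1 - (s - t) / delta) by rewrite /z; field; rewrite gt_eqF.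
    rewrite normrM ler_piMr// ler_norml.
    have : 0 <= (s - t) / delta <= 1.
      rewrite divr_ge0 ?ler_pdivrMr ?mul1r//; last by lra.
      - by rewrite -bt; lra.
      - by lra.
    lra.
  have sx := speed s stb.
  have st0 : `|s - t0| < r.
    have -> : s - t0 = (t - t0) + (s - t) by ring.
    apply: le_lt_trans (ler_normD _ _) _; rewrite (@ger0_norm _ (s - t)); lra.
  have nx : `|gamma s - x0| <= `|gamma s - x| + `|x - x0| by exact: ler_distD.
  have nz : `|gamma s + z - x0| <= `|gamma s - x0| + `|z|.
    by rewrite addrAC; exact: ler_normD.
  apply: h_holder => //.
  - lra.
  - lra.
  - by rewrite addrC addKr; lra.
  - by rewrite subrr normr0 ltW.
have k2 : (- (k / delta)) ^+ 2 * delta <= e.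
  have -> : (- (k / delta)) ^+ 2 * delta = k ^+ 2 / delta by field; rewrite gt_eqF.
  rewrite ler_pdivrMr// /e rho2 -[leLHS]real_normK ?num_real//.
  by rewrite ler_sqr ?nnegrE// ltW.
have JI' : J <= I + C * e by rewrite /e -rhob [delta * _]mulrC mulrA.
have -> : - (k / delta) *+ 2 * (gamma b - x) = 2 * (- ((gamma b - x) / delta) * k).
  by field; rewrite gt_eqF.
(* The errors are [C * e] from the potential, [e] from near-optimality and [e / 2] from the squared
   bend, within [(C + 2) * e]. *)
rewrite -/e; set V := - _ * k; rewrite [x + k]addrC.
lra.
Qed.

(** This gives only an upper bound on increments in space; the lower bound will come from applying
    it to the time-reversed data. *)
Lemma one_sided_slope : exists r' C' : R, [/\ 0 < r', 0 <= C' &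
  forall x t rho : R, `|x - x0| < r' -> `|t - t0| < r' -> 0 < rho < r' ->
    exists v : R, forall k : R, `|k| <= rho ->
      u (x + k) t - u x t <= v * k + C' * rho `^ (1 + beta / 2)].
Proof.
have [K1 b01] := conj K_ge1 beta01.
pose eta := Num.min 1 (r / (K + 3)).
have K3 : 0 < K + 3 by lra.
have eta0 : 0 < eta by rewrite lt_min ltr01 divr_gt0.
have eta1 : eta <= 1 by rewrite ge_min lexx.
have etar : eta * (K + 3) <= r by rewrite -ler_pdivlMr// ge_min lexx orbT.
have eta2 : eta ^+ 2 <= eta by rewrite expr2 ler_piMr// ltW.
exists (eta ^+ 2), (C + 2); split; [by rewrite exprn_gt0|by rewrite addr_ge0|].
move=> x t rho xx tt /andP[rho0 rhoe].
have rho_le1 : rho <= 1 by lra.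
pose delta := rho `^ (1 - beta / 2).
have delta0 : 0 < delta by exact: powR_gt0.
have deltae : delta <= eta.
  apply: (@le_trans _ _ ((eta ^+ 2) `^ (1 - beta / 2))).
    have b2 : 0 <= 1 - beta / 2 by lra.
    by rewrite ge0_ler_powR ?nnegrE ?sqr_ge0 ?(ltW rho0) ?(ltW rhoe).
  rewrite -powR_mulrn ?(ltW eta0)// -powRrM.
  by apply: ge1r_powR; [rewrite eta0|lra].
have Kd : K * delta <= K * eta by rewrite ler_wpM2l// (le_trans ler01 K1).
have Ke : eta * (K + 3) = K * eta + 3 * eta by ring.
have rho_neq0 : rho != 0 by rewrite gt_eqF.
apply: (@one_sided_slope_at _ _ _ delta) => //.
- lra.
- nra.
- by rewrite /delta -powRD ?rho_neq0 ?implybT//; congr (_ `^ _); field.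
- rewrite /delta -powRD ?rho_neq0 ?implybT// -powR_mulrn ?ltW//.
  by congr (_ `^ _); ring.
- by rewrite /delta ger_powR ?rho0//; lra.
Qed.

Lemma potential_close (x t b : R) gamma g : `|x - x0| + K * (b - t) < r ->
  `|t - t0| < r -> `|b - t0| < r -> t < b -> b - t <= 1 ->
  H1_curve t b gamma g ->
  (forall s, t <= s <= b -> `|gamma s - x| <= K * (b - t)) ->
  `|\int[mu]_(s in `[t, b]) h (gamma s) s - h x t * (b - t)| <=
    C * K * (b - t) `^ (1 + beta / 2).
Proof.
move=> xr tr br tb tau1 Hg speed.
have [K1 b01 C0] := And3 K_ge1 beta01 C_ge0.
have tau0 : 0 < b - t by rewrite subr_gt0.
have /andP[/ltW t0' _] := r_strip tr.
have /andP[_ /ltW bT] := r_strip br.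
have iHg := potential_integrable h_cont h_bnd t0' (ltW tb) bT Hg.
have Kt : b - t <= K * (b - t) by rewrite ler_peMl// ltW.
have close s : t <= s <= b -> `|h (gamma s) s - h x t| <= C * (K * (b - t)) `^ beta.
  move=> stb; have sx := speed s stb.
  have nx : `|gamma s - x0| <= `|gamma s - x| + `|x - x0| by exact: ler_distD.
  have := ler_norm (t - t0); have := ler_norm (t0 - t).
  have := ler_norm (b - t0); have := ler_norm (t0 - b).
  rewrite (distrC t0 t) (distrC t0 b) => ? ? ? ?.
  apply: h_holder => //.
  - lra.
  - by rewrite ltr_norml; lra.
  - by apply: le_lt_trans xr; rewrite lerDl; lra.
  - by rewrite ger0_norm; lra.
set D := C * (K * (b - t)) `^ beta.
have DE : D * (b - t) <= C * K * (b - t) `^ (1 + beta / 2).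
  have -> : D * (b - t) = C * ((K * (b - t)) `^ beta * (b - t)) by rewrite mulrA.
  rewrite -[leRHS]mulrA ler_wpM2l//.
  rewrite powRM ?(ltW tau0) ?(le_trans ler01 K1)// -mulrA.
  apply: ler_pM; rewrite ?mulr_ge0 ?powR_ge0 ?(ltW tau0)//.
    by apply: ler1_powR K1 _; case/andP: b01 => _ /ltW.
  rewrite -[X in _ * X](@powRr1 _ (b - t)) ?(ltW tau0)// -powRD; last first.
    by rewrite (gt_eqF tau0) implybT.
  by apply: ger_powR; [rewrite tau0|lra].
have ic := integrable_itv_cst t b (h x t).
have up := le_Rintegral_itvD (ltW tb) iHg ic (c := D).
have lo := le_Rintegral_itvD (ltW tb) ic iHg (c := D).
have {}up : \int[mu]_(s in `[t, b]) h (gamma s) s <= h x t * (b - t) + D * (b - t).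
  rewrite -(Rintegral_itv_cst _ (ltW tb)); apply: up => s stb /=.
  by have := close s stb; rewrite ler_norml -/D; lra.
have {}lo : h x t * (b - t) <= \int[mu]_(s in `[t, b]) h (gamma s) s + D * (b - t).
  rewrite -(Rintegral_itv_cst _ (ltW tb)); apply: lo => s stb /=.
  by have := close s stb; rewrite ler_norml -/D; lra.
by rewrite ler_norml; lra.
Qed.

(* The Hopf-Lax formula over a short time: minimising
   [k^2 / (2 tau) + p k] over the displacement [k] gives [- tau p^2 / 2]. *)
Lemma hopf_lax_expansion (x t b p A : R) : `|x - x0| + K * (b - t) < r ->
  `|t - t0| < r -> `|b - t0| < r -> t < b -> b - t <= 1 -> `|p| <= K ->
  (forall k, `|k| <= K * (b - t) ->
    `|u (x + k) b - u x b - p * k| <= A * (b - t) `^ (1 + beta / 2)) ->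
  `|u x t - u x b + 2^-1 * p ^+ 2 * (b - t) - h x t * (b - t)| <=
    (A + C * K + 1) * (b - t) `^ (1 + beta / 2).
Proof.
move=> xr tr br tb tau1 pK ub.
have [K1 b01 C0] := And3 K_ge1 beta01 C_ge0.
have tau0 : 0 < b - t by rewrite subr_gt0.
have /andP[/ltW t0' _] := r_strip tr.
have /andP[_ /ltW bT] := r_strip br.
set e := (b - t) `^ _ in ub *.
have e0 : 0 < e by exact: powR_gt0.
have etau : e <= b - t by apply: ge1r_powR; [rewrite tau0|lra].
have tbb : t <= b <= b by rewrite (ltW tb) lexx.
(* Test with the straight line of velocity [- p], the minimiser of the quadratic model. *)
have upper : u x t - u x b + 2^-1 * p ^+ 2 * (b - t) - h x t * (b - t) <=
    (A + C * K) * e.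
  have Hl := H1_curve_affine (H1_curve_cst t b x) (- p) 0.
  have speed s : t <= s <= b -> `|x + (- p * (s - t) + 0) - x| <= K * (b - t).
    move=> /andP[ts sb].
    rewrite addr0 addrC addKr normrM normrN.
    by apply: ler_pM => //; rewrite ger0_norm ?lerB ?subr_ge0.
  have := potential_close xr tr br tb tau1 Hl speed; rewrite -/e.
  have := value_le_before h_cont h_bnd u_value t0' (ltW tb) bT Hl.
  rewrite (Rintegral_sqr_affine (ltW tb) (H1_curve_cst t b x)) subrr !mulr0 !addr0.
  have -> : \int[mu]_(s in `[t, b]) (0 : R) ^+ 2 = 0.
    by rewrite expr0n Rintegral_itv_cst ?(ltW tb)// mul0r.
  set J := Rintegral _ _ _.
  have := ub (- p * (b - t)); rewrite normrM normrN (gtr0_norm tau0).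
  rewrite ler_pM2r// => /(_ pK); rewrite !ler_norml sqrrN => /andP[_ H1] H2 /andP[_ H3].
  nra.
have lower : - ((A + C * K + 1) * e) <=
    u x t - u x b + 2^-1 * p ^+ 2 * (b - t) - h x t * (b - t).
  have [gamma [g [gx Hg opt]]] :=
    value_near_optimal_before h_cont h_bnd u_value x t0' (ltW tb) bT e0.
  have speed s : t <= s <= b -> `|gamma s - x| <= K * (b - t).
    move=> stb; rewrite -gx; apply: (near_optimal_speed t0' tb bT Hg) => //.
    by rewrite gx; apply: le_trans opt _; rewrite lerD2l.
  have := potential_close xr tr br tb tau1 Hg speed; rewrite -/e.
  have := H1_curve_CauchySchwarz tbb Hg; rewrite gx.
  have := ub (gamma b - x) (speed b tbb); rewrite [x + _]addrC subrK.
  move: opt; set J := \int[mu]_(s in _) h _ _; set E := \int[mu]_(s in _) _ ^+ 2.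
  set k := gamma b - x => opt; rewrite !ler_norml => /andP[H1 _] CS /andP[H2 _].
  (* Completing the square: multiplied by [b - t], the right side is at least
     [(k + p * (b - t)) ^+ 2], because [k ^+ 2 <= (b - t) * E]. *)
  have sq : 0 <= E + 2 * (p * k) + p ^+ 2 * (b - t).
    rewrite -(pmulr_rge0 _ tau0).
    have := sqr_ge0 (k + p * (b - t)); nra.
  lra.
by rewrite ler_norml lower/=; lra.
Qed.

End local_estimates.
End near_optimal_curves.

(** * Pointwise expansions of order above one *)

Lemma powR1D {R : realType} (a r : R) : 0 < a -> a `^ (1 + r) = a * a `^ r.
Proof. by move=> a0; rewrite powRD ?(gt_eqF a0) ?implybT// powRr1// ltW. Qed.

Lemma powR2N_lt1 {R : realType} (r : R) : 0 < r -> 2 `^ (- r) < 1 :> R.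
Proof.
move=> /gt0_ltr_powR /(_ 1 2); rewrite !nnegrE => /(_ ler01 (ler0n _ _)).
by rewrite powRN invf_lt1 ?powR_gt0// powR1 => -> //; rewrite ltr1n.
Qed.

Section pointwise_expansion.
Context {R : realType}.
Variables (alpha C r : R).
Hypotheses (alpha_gt0 : 0 < alpha) (C_ge0 : 0 <= C).

Lemma is_derive_expansion (f : R -> R) (x p : R) : 0 < r ->
  (forall k, `|k| < r -> `|f (x + k) - f x - p * k| <= C * `|k| `^ (1 + alpha)) ->
  is_derive x (1 : R) f p.
Proof.
move=> r0 fE.
have cv : h^-1 *: ((f \o shift x) (h *: (1 : R)) - f x) @[h --> 0^'] --> p.
  apply/cvgrPdist_le => /= e e0.
  have C1 : 0 < C + 1 by rewrite ltr_wpDl.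
  pose d := (e / (C + 1)) `^ alpha^-1.
  have d0 : 0 < d by rewrite powR_gt0// divr_gt0.
  near=> h.
  have h0 : h != 0 by near: h; exact: nbhs_dnbhs_neq.
  have hr : `|h| < r by near: h; exact: dnbhs0_lt.
  have hd : `|h| <= d by near: h; exact: dnbhs0_le.
  have hp : 0 < `|h| by rewrite normr_gt0.
  rewrite /= [h *: _]mulr1 [h + x]addrC.
  have -> : p - h^-1 * (f (x + h) - f x) = - h^-1 * (f (x + h) - f x - p * h).
    by field.
  rewrite normrM normrN normfV mulrC ler_pdivrMr//.
  apply: le_trans (fE _ hr) _.
  rewrite powR1D// mulrCA mulrC ler_pM2r//.
  apply: (@le_trans _ _ ((C + 1) * `|h| `^ alpha)).
    by rewrite ler_wpM2r ?powR_ge0// lerDl.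
  rewrite mulrC -ler_pdivlMr//.
  have -> : e / (C + 1) = d `^ alpha.
    by rewrite -powRrM mulVf ?gt_eqF// powRr1// divr_ge0// ltW.
  by rewrite ge0_ler_powR// ?nnegrE ltW.
split; [exact: cvgP cv|exact: cvg_lim cv].
Unshelve. all: by end_near. Qed.

Variables (f : R -> R) (x : R).

(** Campanato's condition at one scale; the slope [v] may change with [rho]. *)
Let slope rho v :=
  forall k, `|k| <= rho -> `|f (x + k) - f x - v * k| <= C * rho `^ (1 + alpha).

(** Sum of the geometric series of slope changes over successive halvings, that is, the fixed point
    recorded in [KE]. *)
Let K := 4 * C / (1 - 2 `^ (- alpha)).

Let q_lt1 := powR2N_lt1 alpha_gt0.

Let K_ge0 : 0 <= K.
Proof. by rewrite /K !mulr_ge0// invr_ge0 subr_ge0 ltW. Qed.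

Let KE : K * 2 `^ (- alpha) + 4 * C = K.
Proof. by rewrite /K; field; rewrite subr_eq0 gt_eqF. Qed.

Let KC : 4 * C <= K.
Proof. by rewrite -{1}KE lerDr mulr_ge0// powR_ge0. Qed.

(** Both approximations are tested at [k = sigma]; dividing their difference by [sigma], comparable
    to [rho], loses one power. *)
Let slope_double rho v sigma w : 0 < sigma -> sigma <= rho -> rho <= 2 * sigma ->
  slope rho v -> slope sigma w -> `|v - w| <= 4 * C * rho `^ alpha.
Proof.
have C0 := C_ge0; have a0 := alpha_gt0.
move=> s0 sr r2s fv fw.
have rho0 : 0 < rho by exact: lt_le_trans sr.
have s' : `|sigma| = sigma by rewrite gtr0_norm.
have := fv sigma; rewrite s' => /(_ sr) {}fv.
have := fw sigma; rewrite s' => /(_ (lexx _)) {}fw.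
have ple : sigma `^ (1 + alpha) <= rho `^ (1 + alpha).
  by rewrite ge0_ler_powR// ?nnegrE ?ltW//; lra.
rewrite -(ler_pM2l s0).
have -> : sigma * `|v - w| = `|v * sigma - w * sigma|.
  by rewrite -mulrBl normrM s' mulrC.
move: fv fw; rewrite !ler_norml.
have -> : rho `^ (1 + alpha) = rho * rho `^ alpha.
  exact: powR1D.
move: ple; set P := sigma `^ _.
have -> : rho `^ (1 + alpha) = rho * rho `^ alpha.
  exact: powR1D.
have := powR_ge0 rho alpha; set Q := rho `^ alpha => Q0 PQ.
have CP : C * P <= C * (rho * Q) by rewrite ler_wpM2l.
have CQ : C * (rho * Q) <= 2 * (sigma * (C * Q)).
  have -> : C * (rho * Q) = rho * (C * Q) by ring.
  by rewrite mulrA ler_wpM2r// mulr_ge0.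
lra.
Qed.

Hypothesis slopes : forall rho, 0 < rho < r -> exists v, slope rho v.

Let slope_chain n rho v sigma w :
  0 < sigma -> sigma <= rho -> rho <= 2 ^+ n * sigma -> rho < r ->
  slope rho v -> slope sigma w -> `|v - w| <= K * rho `^ alpha.
Proof.
elim: n rho v => [|n IH] rho v s0 sr rn rr fv fw.
  apply: le_trans (slope_double s0 sr _ fv fw) _; last by rewrite ler_wpM2r ?powR_ge0.
  by move: rn; rewrite expr0; lra.
have [r2|r2] := leP rho (2 * sigma).
  apply: le_trans (slope_double s0 sr _ fv fw) _ => //.
  by rewrite ler_wpM2r ?powR_ge0.
have rho0 : 0 < rho by lra.
have [w' fw'] : exists w', slope (rho / 2) w' by apply: slopes; lra.
have h1 : `|w' - w| <= K * (rho / 2) `^ alpha.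
  apply: IH => //; [lra| |lra].
  by move: rn; rewrite exprS -mulrA => rn; lra.
have h2 : `|v - w'| <= 4 * C * rho `^ alpha by apply: slope_double fv fw'; lra.
have -> : v - w = (v - w') + (w' - w) by ring.
apply: le_trans (ler_normD _ _) _.
have -> : K * rho `^ alpha = 4 * C * rho `^ alpha + K * 2 `^ (- alpha) * rho `^ alpha.
  by rewrite -{1}KE mulrDl addrC.
apply: lerD => //.
apply: le_trans h1 _.
have -> : (rho / 2) `^ alpha = 2 `^ (- alpha) * rho `^ alpha.
  rewrite powRM ?(ltW rho0) ?invr_ge0//.
  by rewrite -(powR_inv1 (ler0n _ 2)) -powRrM mulN1r mulrC.
by rewrite mulrA.
Qed.

Let slope_any rho v sigma w : 0 < sigma -> sigma <= rho -> rho < r ->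
  slope rho v -> slope sigma w -> `|v - w| <= K * rho `^ alpha.
Proof.
move=> s0 sr rr fv fw.
pose n := Num.bound (rho / sigma).
apply: (slope_chain (n := n) s0 sr _ rr fv fw).
rewrite -ler_pdivrMr//; apply: (@le_trans _ _ n%:R).
  have rs : 0 <= rho / sigma by rewrite divr_ge0 ?ltW// (lt_le_trans s0).
  by have := archi_boundP rs => /ltW.
by rewrite -natrX ler_nat; apply: ltnW; exact: ltn_expl.
Qed.

(** The limit slope is taken as the supremum of the lower bounds [v - K * rho]^
    alpha[; by]slope_any[every]v + K * rho [^ alpha] is above all of them. The scale [rho = |k|]
    then gives the constant [C + K]. *)
Lemma pointwise_expansion : exists p, forall k, `|k| < r ->
  `|f (x + k) - f x - p * k| <=
    (C + 4 * C / (1 - 2 `^ (- alpha))) * `|k| `^ (1 + alpha).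
Proof.
pose S := [set z | exists rho v, [/\ 0 < rho < r, slope rho v & z = v - K * rho `^ alpha]].
have ubS rho v : 0 < rho < r -> slope rho v -> ubound S (v + K * rho `^ alpha).
  move=> /andP[r0 rr] fv _ [sigma [w [/andP[s0 ss] fw ->]]].
  have Kr : 0 <= K * rho `^ alpha by rewrite mulr_ge0 ?powR_ge0.
  have Ks : 0 <= K * sigma `^ alpha by rewrite mulr_ge0 ?powR_ge0.
  have [sr|/ltW rs] := leP sigma rho.
    have := slope_any s0 sr rr fv fw; rewrite ler_norml; lra.
  have := slope_any r0 rs ss fw fv; rewrite ler_norml; lra.
exists (sup S) => k kr.
have [->|k0] := eqVneq k 0.
  by rewrite addr0 subrr mulr0 subr0 normr0 mulr_ge0 ?powR_ge0// addr_ge0.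
have kp : 0 < `|k| by rewrite normr_gt0.
have kk : 0 < `|k| < r by rewrite kp.
have [v fv] := slopes kk.
have Sv : S (v - K * `|k| `^ alpha) by exists `|k|, v.
have up : sup S <= v + K * `|k| `^ alpha.
  by apply: ge_sup; [exists (v - K * `|k| `^ alpha)|exact: ubS].
have lo : v - K * `|k| `^ alpha <= sup S.
  by apply: ub_le_sup Sv; exists (v + K * `|k| `^ alpha); exact: ubS.
have vp : `|v - sup S| <= K * `|k| `^ alpha by rewrite ler_norml; lra.
have -> : f (x + k) - f x - sup S * k = (f (x + k) - f x - v * k) + (v - sup S) * k.
  by ring.
apply: le_trans (ler_normD _ _) _; rewrite -/K [leRHS]mulrDl; apply: lerD.
  exact: fv.
by rewrite normrM powR1D// mulrCA mulrC ler_pM2l.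
Qed.

End pointwise_expansion.

(** * From expansions to Hoelder derivatives *)

Section local_regularity.
Context {R : realType}.
Variables (alpha x0 t0 r A P : R) (u h ux : R -> R -> R).
Hypotheses (alpha_gt0 : 0 < alpha) (r_gt0 : 0 < r) (r_le1 : r <= 1).
Hypotheses (A_ge0 : 0 <= A) (P_ge0 : 0 <= P).
Hypothesis ux_bound : forall x t : R, `|x - x0| < r -> `|t - t0| < r -> `|ux x t| <= P.
Hypothesis u_space : forall x t k : R, `|x - x0| < r -> `|t - t0| < r -> `|k| < r ->
  `|u (x + k) t - u x t - ux x t * k| <= A * `|k| `^ (1 + alpha).
Hypothesis u_time : forall x t b : R, `|x - x0| < r -> `|t - t0| < r ->
  `|b - t0| < r -> t < b ->
  `|u x t - u x b + 2^-1 * ux x b ^+ 2 * (b - t) - h x t * (b - t)| <=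
    A * (b - t) `^ (1 + alpha).
Hypothesis h_holder : forall x s y t d : R, `|x - x0| < r -> `|s - t0| < r ->
  `|y - x0| < r -> `|t - t0| < r -> `|x - y| <= d -> `|s - t| <= d -> d <= 1 ->
  `|h x s - h y t| <= A * d `^ alpha.

(** Add the expansion at [x] evaluated at [y] to the one at [y] evaluated at [x]: the values of [u]
    cancel, leaving the slope difference times [x - y]. *)
Lemma gradient_holder_space (x y t : R) : `|x - x0| < r -> `|y - x0| < r ->
  `|t - t0| < r -> `|x - y| < r ->
  `|ux x t - ux y t| <= 2 * A * `|x - y| `^ alpha.
Proof.
move=> xr yr tr xy.
have [->|xNy] := eqVneq x y.
  by rewrite subrr normr0 !mulr_ge0 ?powR_ge0.
have d0 : 0 < `|x - y| by rewrite normr_gt0 subr_eq0.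
have yx : `|y - x| < r by rewrite distrC.
have := u_space yr tr xy; have := u_space xr tr yx.
rewrite (distrC y x) ![_ + (_ - _)]addrC !subrK powR1D// => H1 H2.
rewrite -(ler_pM2l d0) mulrC -normrM.
have -> : (ux x t - ux y t) * (x - y) =
   (u y t - u x t - ux x t * (y - x)) + (u x t - u y t - ux y t * (x - y)) by ring.
apply: le_trans (ler_normD _ _) _.
move: (lerD H1 H2) => /le_trans; apply.
by rewrite le_eqVlt; apply/orP; left; apply/eqP; ring.
Qed.

Lemma sqr_gradient_holder (a b c : R) : `|a| <= P -> `|b| <= P -> `|a - b| <= c ->
  `|2^-1 * a ^+ 2 - 2^-1 * b ^+ 2| <= P * c.
Proof.
move=> aP bP abc.
have -> : 2^-1 * a ^+ 2 - 2^-1 * b ^+ 2 = (2^-1 * (a + b)) * (a - b) by field.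
rewrite normrM ler_pM// normrM ger0_norm ?invr_ge0//.
have := ler_normD a b; lra.
Qed.

(** Two errors [A] from the space edges, two from the time edges, one from [h], and [2 * P * A] from
    the squared gradient. *)
Let B := (5 + 2 * P) * A.

(* The mixed difference of [u] over the square with side [b - t], computed along
   its space edges and along its time edges. *)
Lemma gradient_holder_time (x t b : R) : `|x - x0| < r / 3 -> `|t - t0| < r / 3 ->
  `|b - t0| < r / 3 -> t < b ->
  `|ux x t - ux x b| <= B * (b - t) `^ alpha.
Proof.
have [a0 r0 r1] := And3 alpha_gt0 r_gt0 r_le1.
move=> xr tr br tb.
have tau0 : 0 < b - t by rewrite subr_gt0.
(* With thirds of [r], the shifted corner [x + (b - t)] still lies within [r] of [x0]. *)
have taur : b - t < r * (2 / 3).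
  move: (tr) (br); rewrite !ltr_norml; lra.
have [xr' tr' br'] : [/\ `|x - x0| < r, `|t - t0| < r & `|b - t0| < r].
  by split; lra.
have tauE : `|b - t| = b - t by rewrite gtr0_norm.
have xtr : `|x + (b - t) - x0| < r.
  by rewrite addrAC; apply: le_lt_trans (ler_normD _ _) _; rewrite tauE; lra.
have taur' : `|b - t| < r by rewrite tauE; lra.
have Ha := u_space xr' br' taur'.
have Hb := u_space xr' tr' taur'.
have Hc := u_time xr' tr' br' tb.
have Hd := u_time xtr tr' br' tb.
have He : `|ux (x + (b - t)) b - ux x b| <= 2 * A * (b - t) `^ alpha.
  have xx : x + (b - t) - x = b - t by ring.
  by have := gradient_holder_space xtr xr' br'; rewrite xx tauE; apply; lra.
have Hf : `|h (x + (b - t)) t - h x t| <= A * (b - t) `^ alpha.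
  apply: h_holder => //; [|by rewrite subrr normr0 ltW|lra].
  by rewrite addrC addKr tauE.
have He' := sqr_gradient_holder (ux_bound xtr br') (ux_bound xr' br') He.
rewrite tauE in Ha Hb.
rewrite -(ler_pM2l tau0) -{1}tauE -normrM.
have mulB c z : `|c| <= z * (b - t) `^ alpha ->
    `|c * (b - t)| <= z * (b - t) `^ (1 + alpha).
  by move=> cz; rewrite normrM tauE mulrC powR1D// mulrCA ler_pM2l.
have {}Hf := mulB _ _ Hf.
have {}He' : `|(2^-1 * ux (x + (b - t)) b ^+ 2 - 2^-1 * ux x b ^+ 2) * (b - t)|
   <= P * (2 * A) * (b - t) `^ (1 + alpha).
  by apply: mulB; rewrite -[leRHS]mulrA.
have -> : (b - t) * (B * (b - t) `^ alpha) = B * (b - t) `^ (1 + alpha).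
  by rewrite powR1D// mulrCA.
move: Ha Hb Hc Hd Hf He'; rewrite /B !mulrBl; set q := (b - t) `^ (1 + alpha).
set y := x + (b - t).
rewrite !ler_norml => /andP[Ha1 Ha2] /andP[Hb1 Hb2] /andP[Hc1 Hc2] /andP[Hd1 Hd2].
move=> /andP[Hf1 Hf2] /andP[He1 He2].
lra.
Qed.

Lemma gradient_holder (x s y t d : R) : `|x - x0| < r / 3 -> `|s - t0| < r / 3 ->
  `|y - x0| < r / 3 -> `|t - t0| < r / 3 -> `|x - y| <= d -> `|s - t| <= d ->
  `|ux x s - ux y t| <= (2 * A + B) * d `^ alpha.
Proof.
have [a0 r0 r1] := And3 alpha_gt0 r_gt0 r_le1.
have [A0 P0] := conj A_ge0 P_ge0.
move=> xr sr yr tr xyd std.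
have d0 : 0 <= d := le_trans (normr_ge0 _) xyd.
have B0 : 0 <= B by rewrite /B mulr_ge0//; lra.
have mono z : 0 <= z -> z <= d -> z `^ alpha <= d `^ alpha.
  by move=> z0 zd; rewrite ge0_ler_powR ?nnegrE ?(ltW a0).
have space : `|ux x s - ux y s| <= 2 * A * d `^ alpha.
  apply: (@le_trans _ _ (2 * A * `|x - y| `^ alpha)).
    apply: gradient_holder_space; [lra|lra|lra|].
    by move: xr yr; rewrite !ltr_norml; lra.
  by rewrite ler_wpM2l ?mulr_ge0// mono.
have time : `|ux y s - ux y t| <= B * d `^ alpha.
  have [->|sNt] := eqVneq s t.
    by rewrite subrr normr0 mulr_ge0 ?powR_ge0.
  apply: (@le_trans _ _ (B * `|s - t| `^ alpha)); last by rewrite ler_wpM2l// mono.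
  have [st|ts|/eqP] := ltgtP s t; last by rewrite (negbTE sNt).
  - have -> : `|s - t| = t - s by rewrite distrC gtr0_norm ?subr_gt0.
    exact: gradient_holder_time.
  - have -> : `|s - t| = s - t by rewrite gtr0_norm ?subr_gt0.
    by rewrite distrC; exact: gradient_holder_time.
rewrite mulrDl; apply: le_trans (ler_distD (ux y s) _ _) _; exact: lerD.
Qed.

Lemma time_derivative_holder (x s y t d : R) :
  `|x - x0| < r / 3 -> `|s - t0| < r / 3 ->
  `|y - x0| < r / 3 -> `|t - t0| < r / 3 -> `|x - y| <= d -> `|s - t| <= d -> d <= 1 ->
  `|(2^-1 * ux x s ^+ 2 - h x s) - (2^-1 * ux y t ^+ 2 - h y t)| <=
     (P * (2 * A + B) + A) * d `^ alpha.
Proof.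
have [a0 r0 r1] := And3 alpha_gt0 r_gt0 r_le1.
move=> xr sr yr tr xyd std d1.
have [xr' sr' yr' tr'] : [/\ `|x - x0| < r, `|s - t0| < r, `|y - x0| < r & `|t - t0| < r].
  by split; lra.
have G := gradient_holder xr sr yr tr xyd std.
have := sqr_gradient_holder (ux_bound xr' sr') (ux_bound yr' tr') G.
have := h_holder xr' sr' yr' tr' xyd std d1.
rewrite !ler_norml; lra.
Qed.

(** [u_time] takes [ux] at the later time and [h] at the earlier one. For [k < 0] only [h] must be
    moved to [t0], costing [A]; for [k > 0] only [ux], costing [P * B]. *)
Lemma u_time_expansion (x k : R) : `|x - x0| < r / 3 -> `|k| < r / 3 ->
  `|u x (t0 + k) - u x t0 - (2^-1 * ux x t0 ^+ 2 - h x t0) * k| <=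
    (P * B + 2 * A) * `|k| `^ (1 + alpha).
Proof.
have [a0 r0 r1] := And3 alpha_gt0 r_gt0 r_le1.
move=> xr kr.
have x_r : `|x - x0| < r by lra.
have tk : t0 + k - t0 = k by ring.
have tt : t0 - t0 = 0 :> R by rewrite subrr.
have tr' : `|t0 - t0| < r / 3 by rewrite tt normr0; lra.
have tr : `|t0 - t0| < r by rewrite tt normr0.
have kr' : `|t0 + k - t0| < r / 3 by rewrite tk.
have kr'' : `|t0 + k - t0| < r by lra.
have A0 := A_ge0; have P0 := P_ge0.
have PB : 0 <= P * B by rewrite !mulr_ge0//; lra.
have [k0|k0|->] := ltgtP k 0.
- have lt : t0 + k < t0 by lra.
  have kE : t0 - (t0 + k) = - k by ring.
  have kN : `|k| = - k by rewrite ltr0_norm.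
  have k1 : 0 < - k by lra.
  have Hh : `|h x (t0 + k) - h x t0| <= A * `|k| `^ alpha.
    by apply: h_holder => //; [rewrite subrr normr0|rewrite tk|lra].
  have := u_time x_r kr'' tr lt; rewrite kE kN powR1D// => Ht.
  have {}Hh : `|(h x (t0 + k) - h x t0) * k| <= A * ((- k) * (- k) `^ alpha).
    by rewrite normrM mulrC kN [leRHS]mulrCA ler_pM2l// -kN.
  have : 0 <= P * B * (- k * (- k) `^ alpha) by
    apply: mulr_ge0 => //; apply: mulr_ge0; [exact: ltW|exact: powR_ge0].
  move: Ht Hh; set q := - k * _; rewrite !ler_norml; nra.
- have lt : t0 < t0 + k by lra.
  have kE : t0 + k - t0 = k by ring.
  have kN : `|k| = k by rewrite gtr0_norm.
  have := u_time x_r tr kr'' lt; rewrite kE kN powR1D// => Ht.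
  have G := gradient_holder_time xr tr' kr' lt; rewrite kE in G.
  have := sqr_gradient_holder (ux_bound x_r tr) (ux_bound x_r kr'') G => S.
  have {}S : `|(2^-1 * ux x t0 ^+ 2 - 2^-1 * ux x (t0 + k) ^+ 2) * k| <=
      P * B * (k * k `^ alpha).
    by rewrite normrM mulrC kN [leRHS]mulrCA ler_pM2l// -mulrA.
  have : 0 <= A * (k * k `^ alpha) by
    apply: mulr_ge0 => //; apply: mulr_ge0; [exact: ltW|exact: powR_ge0].
  move: Ht S; set q := k * k `^ _; rewrite !ler_norml; nra.
- rewrite addr0 subrr mulr0 subr0 normr0 mulr_ge0 ?powR_ge0//; lra.
Qed.

End local_regularity.

(** * Combining both time directions, and the final assembly *)

Lemma lipschitz_derive_bound (R : realType) (f : R -> R) (x p L : R) :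
  (forall y, `|f y - f x| <= L * `|y - x|) -> is_derive x (1 : R) f p -> `|p| <= L.
Proof.
move=> fL [df pE]; apply/ler_addgt0Pr => e e0.
have cv : h^-1 *: ((f \o shift x) (h *: (1 : R)) - f x) @[h --> 0^'] --> p.
  by rewrite -pE; exact: df.
near (0 : R)^' => h.
have h0 : h != 0 by near: h; exact: nbhs_dnbhs_neq.
have hp : 0 < `|h| by rewrite normr_gt0.
have : `|p - h^-1 *: ((f \o shift x) (h *: (1 : R)) - f x)| <= e.
  by near: h; move/cvgrPdist_le : cv; exact.
set q := h^-1 *: _ => pq.
have qL : `|q| <= L.
  rewrite /q normrM normfV mulrC ler_pdivrMr//=.
  by have := fL (h *: 1 + x); rewrite addrK [h *: _]mulr1.
rewrite -[p](subrK q) addrC [leRHS]addrC.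
by apply: le_trans (ler_normD _ _) _; rewrite addrC; exact: lerD.
Unshelve. all: by end_near. Qed.

(** Adding the bounds gives [0 <= (v1 + v2) * k + e1 + e2]; at [k = rho] and [k = - rho] this forces
    [v2] close to [- v1], so the second bound becomes a lower bound with slope [v1]. *)
Lemma two_sided_slope (R : realType) (f : R -> R) (x rho v1 v2 e1 e2 : R) :
  0 < rho -> 0 <= e2 ->
  (forall k, `|k| <= rho -> f (x + k) - f x <= v1 * k + e1) ->
  (forall k, `|k| <= rho -> - f (x + k) - - f x <= v2 * k + e2) ->
  forall k, `|k| <= rho -> `|f (x + k) - f x - v1 * k| <= e1 + 2 * e2.
Proof.
move=> rho0 e20 up lo k krho.
have rhoE : `|rho| <= rho by rewrite gtr0_norm.
have rhoN : `|- rho| <= rho by rewrite normrN.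
have v12 : `|(v1 + v2) * k| <= e1 + e2.
  rewrite normrM; apply: (@le_trans _ _ (`|v1 + v2| * rho)); first by rewrite ler_wpM2l.
  rewrite -[X in _ * X](gtr0_norm rho0) -normrM ler_norml.
  have := up _ rhoE; have := lo _ rhoE; have := up _ rhoN; have := lo _ rhoN.
  lra.
have := up k krho; have := lo k krho.
move: v12; rewrite !ler_norml mulrDl; lra.
Qed.

Section regularity.
Context {R : realType}.
Variables (T beta M L : R) (h u : R -> R -> R).
Hypotheses (T_gt0 : 0 < T) (beta01 : 0 < beta < 1).
Hypothesis h_cont :
  {within [set p : R * R | 0 <= p.2 <= T], continuous (fun p => h p.1 p.2)}.
Hypothesis h_bnd : forall x t : R, 0 <= t <= T -> `|h x t| <= M.
Hypothesis h_holder : loc_holder_strip beta T h.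
Hypothesis u_lip : forall x s y t : R, 0 <= s <= T -> 0 <= t <= T ->
       `|u x s - u y t| <= L * (`|x - y| + `|s - t|).
Hypothesis u_value : forall x t : R, 0 <= t <= T ->
  (u x t)%:E = value h (fun y => u y T) T x t.
Hypothesis w_value : forall x t : R, 0 <= t <= T ->
  (- u x (T - t))%:E =
    value (fun y s => h y (T - s)) (fun y => - u y 0) T x t.

Let reverse_strip (t : R) : 0 <= t <= T -> 0 <= T - t <= T.
Proof. by case/andP => t0 tT; rewrite subr_ge0 tT lerBlDr lerDl. Qed.

(** The time-reversed data [rh] and [w] satisfy the same assumptions as [h] and [u], so the
    one-sided estimates apply to them verbatim. *)
Let rh (x t : R) : R := h x (T - t).
Let w (x t : R) : R := - u x (T - t).

Let rh_cont :
  {within [set p : R * R | 0 <= p.2 <= T], continuous (fun p => rh p.1 p.2)}.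
Proof.
apply/subspace_continuousP => p pT.
have qT : [set p : R * R | 0 <= p.2 <= T] (p.1, T - p.2) by exact: reverse_strip.
move/subspace_continuousP : h_cont => /(_ _ qT) ch.
apply: (@cvg_comp _ _ _ (fun r => (r.1, T - r.2)) (fun p => h p.1 p.2)); last exact: ch.
have c1 : r.1 @[r --> within [set p : R * R | 0 <= p.2 <= T] (nbhs p)] --> p.1.
  by apply: cvg_within_filter; exact: cvg_fst.
have c2 : T - r.2 @[r --> within [set p : R * R | 0 <= p.2 <= T] (nbhs p)] --> T - p.2.
  by apply: cvg_within_filter; apply: cvgB; [exact: cvg_cst|exact: cvg_snd].
have cp : (r.1, T - r.2) @[r --> within [set p : R * R | 0 <= p.2 <= T] (nbhs p)]
    --> (p.1, T - p.2) by exact: cvg_pair c1 c2.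
move=> P; rewrite nbhs_simpl/= => wP; have := cp _ wP; rewrite !nbhs_simpl/=.
rewrite /within/= => H; near=> r => rab.
by have := near H r; apply => //; exact: reverse_strip.
Unshelve. all: by end_near. Qed.

Let rh_bnd (x t : R) : 0 <= t <= T -> `|rh x t| <= M.
Proof. by move=> /reverse_strip; exact: h_bnd. Qed.

Let w_lip (x s y t : R) : 0 <= s <= T -> 0 <= t <= T ->
  `|w x s - w y t| <= L * (`|x - y| + `|s - t|).
Proof.
move=> /reverse_strip s' /reverse_strip t'.
have -> : w x s - w y t = u y (T - t) - u x (T - s) by rewrite /w; ring.
have := u_lip y x t' s'; have -> : T - t - (T - s) = s - t by ring.
by rewrite (distrC y x).
Qed.

Let w_value' (x t : R) : 0 <= t <= T -> (w x t)%:E = value rh (fun y => w y T) T x t.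
Proof.
move=> /w_value ->; congr (value _ _ _ _ _).
by apply/funext => y; rewrite /w subrr.
Qed.

(** A global definition, so that the slopes found near different base points are values of a single
    function. *)
Let ux (x t : R) : R := 'D_1 (fun y : R => u y t) x.
(* The Hamilton-Jacobi equation [- u_t + u_x ^ 2 / 2 = h] solved for [u_t]. *)
Let ut (x t : R) : R := 2^-1 * ux x t ^+ 2 - h x t.

(** Forward slopes at [t0] and reversed slopes at [T - t0] combine into two-sided ones at every
    scale; [pointwise_expansion] then yields the derivative. *)
Let space_expansion (x0 t0 : R) : 0 < t0 < T -> exists r A : R, [/\ 0 < r, 0 <= A &
  forall x t : R, `|x - x0| < r -> `|t - t0| < r ->
    is_derive x (1 : R) (fun y : R => u y t) (ux x t) /\
    forall k, `|k| < r ->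
      `|u (x + k) t - u x t - ux x t * k| <= A * `|k| `^ (1 + beta / 2)].
Proof.
have [b01 T0] := conj beta01 T_gt0.
move=> t0T.
have [r [C [r0 C0 r_strip hC]]] :=
  loc_holder_ball x0 (ltW (proj1 (andP b01))) t0T h_holder.
have [r1 [C1 [r10 C10 up]]] := one_sided_slope T_gt0 h_cont h_bnd u_value u_lip
  b01 r0 C0 r_strip hC.
have rE (s : R) : T - s - t0 = - (s - (T - t0)) by ring.
have r_strip' (s : R) : `|s - (T - t0)| < r -> 0 < s < T.
  by rewrite -normrN -rE => /r_strip; lra.
have hC' (x s y t d : R) : `|x - x0| < r -> `|s - (T - t0)| < r ->
    `|y - x0| < r -> `|t - (T - t0)| < r -> `|x - y| <= d -> `|s - t| <= d ->
    `|rh x s - rh y t| <= C * d `^ beta.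
  move=> xr sr yr tr xyd std; apply: hC => //; rewrite ?rE ?normrN//.
  have -> : T - s - (T - t) = - (s - t) by ring.
  by rewrite normrN.
have [r2 [C2 [r20 C20 lo]]] := one_sided_slope T_gt0 rh_cont rh_bnd w_value' w_lip
  b01 r0 C0 r_strip' hC'.
pose r' := Num.min r1 r2.
have r'0 : 0 < r' by rewrite lt_min r10.
have [rr1 rr2] : r' <= r1 /\ r' <= r2 by rewrite !ge_min !lexx orbT.
have a0 : 0 < beta / 2 by lra.
have C12 : 0 <= C1 + 2 * C2 by lra.
pose A := (C1 + 2 * C2) + 4 * (C1 + 2 * C2) / (1 - 2 `^ (- (beta / 2))).
have q1 := powR2N_lt1 a0.
have A0 : 0 <= A.
  by rewrite addr_ge0// divr_ge0 ?mulr_ge0// subr_ge0 ltW.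
exists r', A; split => // x t xr tr.
have [p pE] : exists p, forall k, `|k| < r' ->
    `|u (x + k) t - u x t - p * k| <= A * `|k| `^ (1 + beta / 2).
  apply: (pointwise_expansion a0 C12 (f := fun y => u y t)) => rho /andP[rho0 rhor].
  have rho1 : 0 < rho < r1 by rewrite rho0 (lt_le_trans rhor).
  have rho2 : 0 < rho < r2 by rewrite rho0 (lt_le_trans rhor).
  have tr2 : `|T - t - (T - t0)| < r2.
    have -> : T - t - (T - t0) = - (t - t0) by ring.
    by rewrite normrN (lt_le_trans tr).
  have [v1 v1E] := up x t rho (lt_le_trans xr rr1) (lt_le_trans tr rr1) rho1.
  have [v2 v2E] := lo x (T - t) rho (lt_le_trans xr rr2) tr2 rho2.
  exists v1 => k krho.
  rewrite mulrDl -mulrA.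
  apply: (two_sided_slope (f := fun y => u y t) (v2 := v2) rho0) => //.
    by rewrite mulr_ge0// powR_ge0.
  by move=> k' /v2E; rewrite /w subKr.
have d := is_derive_expansion a0 A0 (f := fun y => u y t) r'0 pE.
have uxp : ux x t = p by exact: derive_val.
by rewrite uxp; split.
Qed.

Let ux_bound (x t : R) : 0 < t < T -> `|ux x t| <= L.
Proof.
move=> tT; have [r [A [r0 A0]]] := space_expansion x tT.
move=> /(_ x t); rewrite !subrr normr0 => /(_ r0 r0)[d _].
have tT' : 0 <= t <= T by case/andP : tT => ? ?; rewrite !ltW.
apply: lipschitz_derive_bound d => y.
by have := u_lip y x tT' tT'; rewrite subrr normr0 addr0.
Qed.

Let L_ge0 : 0 <= L.
Proof.
apply: le_trans (normr_ge0 (ux 0 (T / 2))) _; apply: ux_bound.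
have := T_gt0; lra.
Qed.

(** Collects on a single ball, with a single constant, the expansions and Hoelder bound that the
    local regularity lemmas assume. *)
Let local_expansion (x0 t0 : R) : 0 < t0 < T -> exists r A : R, [/\ 0 < r, r <= 1, 0 <= A &
  [/\ forall t : R, `|t - t0| < r -> 0 < t < T,
  forall x t k : R, `|x - x0| < r -> `|t - t0| < r -> `|k| < r ->
    `|u (x + k) t - u x t - ux x t * k| <= A * `|k| `^ (1 + beta / 2),
  forall x t b : R, `|x - x0| < r -> `|t - t0| < r ->
    `|b - t0| < r -> t < b ->
    `|u x t - u x b + 2^-1 * ux x b ^+ 2 * (b - t) - h x t * (b - t)| <=
    A * (b - t) `^ (1 + beta / 2) &
  forall x s y t d : R, `|x - x0| < r -> `|s - t0| < r ->
    `|y - x0| < r -> `|t - t0| < r -> `|x - y| <= d -> `|s - t| <= d -> d <= 1 ->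
    `|h x s - h y t| <= A * d `^ (beta / 2)]].
Proof.
have [b01 L0] := conj beta01 L_ge0.
move=> t0T.
have [r1 [C [r10 C0 r_strip hC]]] :=
  loc_holder_ball x0 (ltW (proj1 (andP b01))) t0T h_holder.
have [r2 [A [r20 A0 uA]]] := space_expansion x0 t0T.
pose K := 4 * (L ^+ 2 + L + M + 1).
have t0T' : 0 <= t0 <= T by case/andP : t0T => ? ?; rewrite !ltW.
have M0 : 0 <= M by apply: le_trans (normr_ge0 (h 0 t0)) (h_bnd _ t0T').
have [LK K1] : L <= K /\ 1 <= K by rewrite /K; have := sqr_ge0 L; split; lra.
have K0 : 0 <= K := le_trans ler01 K1.
(* Two times in the ball differ by less than [2 * r], so curves between them move by at most
   [K * (2 * r)]. *)
have [r [r0 rle1 rr1 rr2]] : exists r, [/\ 0 < r, 2 * r <= 1,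
    r + K * (2 * r) <= r1 & r + K * (2 * r) <= r2].
  pose m := Num.min 1 (Num.min r1 r2).
  have m0 : 0 < m by rewrite !lt_min ltr01 r10.
  have [m1 m2 m3] : [/\ m <= 1, m <= r1 & m <= r2] by rewrite !ge_min !lexx !orbT.
  have K2 : 0 < 2 * K + 2 by lra.
  exists (m / (2 * K + 2)); have := divfK (lt0r_neq0 K2) m.
  have := divr_gt0 m0 K2; set r := m / _ => r0 rE.
  have Kr : 0 <= K * r by rewrite mulr_ge0// ltW.
  by split => //; lra.
have Kr : 0 <= K * (2 * r) by apply: mulr_ge0 => //; rewrite mulr_ge0// ltW.
have [rr1' rr2'] : r <= r1 /\ r <= r2.
  by split; [apply: le_trans rr1|apply: le_trans rr2]; rewrite lerDl.
(* The constant of [hopf_lax_expansion], with the space error taken over displacements up to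
   [K * (b - t)]. *)
pose D := A * K `^ (1 + beta / 2) + C * K + 1.
have AK : 0 <= A * K `^ (1 + beta / 2) by rewrite mulr_ge0// powR_ge0.
have CCK : C <= C * K by rewrite ler_peMr.
have [D0 CD] : 0 <= D /\ C <= D by rewrite /D; split; lra.
have [b2 b2' b2''] : [/\ 0 < beta / 2, beta / 2 <= beta & 0 <= 1 + beta / 2] by split; lra.
exists r, (A + D); split; [by []|lra|exact: addr_ge0|split].
- by move=> t tr; apply: r_strip (lt_le_trans tr rr1').
- move=> x t k xr tr kr.
  have [_ H] := uA x t (lt_le_trans xr rr2') (lt_le_trans tr rr2').
  apply: le_trans (H k (lt_le_trans kr rr2')) _.
  by rewrite ler_wpM2r ?powR_ge0// lerDl.
- move=> x t b xr tr br tb.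
  have tau0 : 0 < b - t by rewrite subr_gt0.
  have taur : b - t < 2 * r.
    have -> : b - t = (b - t0) - (t - t0) by ring.
    by apply: le_lt_trans (ler_norm _) _; apply: le_lt_trans (ler_normB _ _) _; lra.
  have Ktau : K * (b - t) <= K * (2 * r) by rewrite ler_wpM2l// ltW.
  have bT : 0 < b < T by apply: r_strip (lt_le_trans br rr1').
  apply: (@le_trans _ _ (D * (b - t) `^ (1 + beta / 2))); last first.
    by rewrite ler_wpM2r ?powR_ge0// lerDr.
  apply: (hopf_lax_expansion T_gt0 h_cont h_bnd u_value u_lip b01 C0 r_strip hC _ _ _ tb).
  + by apply: lt_le_trans rr1; exact: ltr_leD.
  + exact: lt_le_trans tr rr1'.
  + exact: lt_le_trans br rr1'.
  + exact: le_trans (ltW taur) rle1.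
  + exact: le_trans (ux_bound x bT) LK.
  + move=> k kK.
    have [_ H] := uA x b (lt_le_trans xr rr2') (lt_le_trans br rr2').
    have kr2 : `|k| < r2.
      by apply: le_lt_trans (le_trans kK Ktau) _; apply: lt_le_trans rr2; rewrite ltrDr.
    apply: le_trans (H k kr2) _.
    rewrite -mulrA ler_wpM2l// -powRM// ?(ltW tau0)//.
    by apply: ge0_ler_powR => //; rewrite nnegrE// mulr_ge0// ltW.
- move=> x s y t d xr sr yr tr xyd std d1.
  have d0 : 0 <= d := le_trans (normr_ge0 _) xyd.
  have H := hC x s y t d (lt_le_trans xr rr1') (lt_le_trans sr rr1')
    (lt_le_trans yr rr1') (lt_le_trans tr rr1') xyd std.
  apply: le_trans H _; apply: (@le_trans _ _ (C * d `^ (beta / 2))).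
    rewrite ler_wpM2l//.
    (* Lowering the exponent from [beta] to [beta / 2] uses [0 < d <= 1]; at [d = 0] both powers
       vanish. *)
    have [->|dn0] := eqVneq d 0.
      by rewrite !powR0// gt_eqF// (lt_le_trans b2).
    by apply: ger_powR b2'; rewrite lt_neqAle eq_sym dn0 d0.
  by rewrite ler_wpM2r ?powR_ge0// (le_trans CD)// lerDr.
Qed.

Lemma regularity : exists ux ut : R -> R -> R,
  (forall x t : R, 0 < t < T ->
     is_derive x (1 : R) (fun y : R => u y t) (ux x t) /\
     is_derive t (1 : R) (fun s : R => u x s) (ut x t)) /\
  loc_holder_strip (beta / 2) T ux /\
  loc_holder_strip (beta / 2) T ut.
Proof.
have [b01 L0] := conj beta01 L_ge0.
have a0 : 0 < beta / 2 by lra.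
exists ux, ut; split; [|split].
- move=> x t tT; split.
    have [r [A [r0 A0]]] := space_expansion x tT.
    by move=> /(_ x t); rewrite !subrr normr0 => /(_ r0 r0)[].
  have [r [A [r0 r1 A0 [r_strip us ut_ hA]]]] := local_expansion x tT.
  have bnd y s (yr : `|y - x| < r) (sr : `|s - t| < r) := ux_bound y (r_strip _ sr).
  have H := u_time_expansion a0 r0 r1 A0 L0 bnd us ut_ hA (x := x).
  apply: (is_derive_expansion a0 (C := L * ((5 + 2 * L) * A) + 2 * A) (r := r / 3)) => //.
  + by rewrite addr_ge0// ?mulr_ge0// addr_ge0// mulr_ge0.
  + by lra.
  + by move=> k kr; apply: H => //; rewrite subrr normr0; lra.
- move=> x0 t0 t0T.
  have [r [A [r0 r1 A0 [r_strip us ut_ hA]]]] := local_expansion x0 t0T.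
  have bnd y s (yr : `|y - x0| < r) (sr : `|s - t0| < r) := ux_bound y (r_strip _ sr).
  exists (r / 3), (2 * A + (5 + 2 * L) * A); split; first by lra.
  move=> x s y t _ _ xr sr yr tr.
  by apply: (gradient_holder a0 r0 r1 A0 L0 bnd us ut_ hA) => //; rewrite le_max lexx ?orbT.
- move=> x0 t0 t0T.
  have [r [A [r0 r1 A0 [r_strip us ut_ hA]]]] := local_expansion x0 t0T.
  have bnd y s (yr : `|y - x0| < r) (sr : `|s - t0| < r) := ux_bound y (r_strip _ sr).
  exists (r / 3), (L * (2 * A + (5 + 2 * L) * A) + A); split; first by lra.
  move=> x s y t _ _ xr sr yr tr.
  apply: (time_derivative_holder a0 r0 r1 A0 L0 bnd us ut_ hA) => //.
  + by rewrite le_max lexx.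
  + by rewrite le_max lexx orbT.
  + by move: xr yr sr tr; rewrite ge_max !ler_norml !ltr_norml; lra.
Qed.

End regularity.

Theorem theorem4p22 (R : realType) (T beta : R) (h u : R -> R -> R) :
  0 < T -> 0 < beta < 1 ->
  (* h in C_b(R x [0,T]) *)
  {within [set p : R * R | 0 <= p.2 <= T], continuous (fun p => h p.1 p.2)} ->
  (exists M : R, forall x t, 0 <= t <= T -> `|h x t| <= M) ->
  (* h locally beta-Hoelder in R x (0,T) *)
  loc_holder_strip beta T h ->
  (* u bounded and Lipschitz on R x [0,T] *)
  (exists M : R, forall x t, 0 <= t <= T -> `|u x t| <= M) ->
  (exists L : R, forall x s y t, 0 <= s <= T -> 0 <= t <= T ->
       `|u x s - u y t| <= L * (`|x - y| + `|s - t|)) ->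
  (* representation formula for u *)
  (forall x t, 0 <= t <= T ->
     (u x t)%:E = value h (fun y => u y T) T x t) ->
  (* representation formula for w(x,t) = - u(x, T - t) *)
  (forall x t, 0 <= t <= T ->
     (- u x (T - t))%:E =
       value (fun y s => h y (T - s)) (fun y => - u y 0) T x t) ->
  (* conclusion: u in C^{1,beta/2}_loc(R x (0,T)) *)
  exists ux ut : R -> R -> R,
    (forall x t : R, 0 < t < T ->
       is_derive x (1 : R) (fun y : R => u y t) (ux x t) /\
       is_derive t (1 : R) (fun s : R => u x s) (ut x t)) /\
    loc_holder_strip (beta / 2) T ux /\
    loc_holder_strip (beta / 2) T ut.
Proof.
move=> T0 b01 hc [M hM] hH _ [L uL] uv wv.
exact: regularity T0 b01 hc hM hH uL uv wv.
Qed.
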